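(* Let $N\ge2$ and let $c(i,j)$, $1\le i<j\le N$, be real numbers, with associated critical inverse temperatures $\beta^\pm$. Let $C$ be the symmetric $N\times N$ matrix with zeros on the diagonal, with entries $c(i,j)$ for $i<j$ and $c(j,i)$ for $i>j$. If $\beta^+$ is finite, then $$\beta^+\ge-\frac{1}{\lambda_{\min}(C)},$$ where $\lambda_{\min}(C)$ is the smallest eigenvalue of $C$. Similarly, if $\beta^-$ is finite, then $$\beta^-\le-\frac{1}{\lambda_{\max}(C)},$$ where $\lambda_{\max}(C)$ is the largest eigenvalue of $C$.
   Context: Given real numbers $c(i,j)$, $1\le i<j\le N$, set $$T^+=-\min_S\frac{\sum_{i,j\in S:\,i<j}c(i,j)}{|S|-1},\qquad T^-=-\max_S\frac{\sum_{i,j\in S:\,i<j}c(i,j)}{|S|-1},$$ where $S$ ranges over all subsets of $\{1,\dots,N\}$ with $|S|\ge 2$. The critical inverse temperatures are $\beta^-=1/T^-$ if $T^-<0$ and $\beta^-=-\infty$ otherwise; $\beta^+=1/T^+$ if $T^+>0$ and $\beta^+=\infty$ otherwise. (Equivalently, $(\beta^-,\beta^+)$ is the set of real $\beta$ for which $\int_{(\mathbb{S}^2)^N}\prod_{i<j}d(p_i,p_j)^{2c(i,j)\beta}\,\mathrm{d}V^{\otimes N}<\infty$, with $d$ the chordal distance on the unit sphere $\mathbb{S}^2$ and $\mathrm{d}V$ the normalized rotation-invariant volume form.) *)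

(* Defs.v *)
From mathcomp Require Import all_boot all_order all_algebra.
From mathcomp Require Import reals constructive_ereal.

Set Implicit Arguments.
Unset Strict Implicit.
Unset Printing Implicit Defensive.

Import Order.TTheory GRing.Theory Num.Theory.
Local Open Scope ring_scope.

(* The indices 1, ..., N are represented by 'I_N = {0, ..., N-1}.  The family
   c(i,j), i < j, is represented by a function c : 'I_N -> 'I_N -> R of which
   only the values at pairs with i < j are ever used: c is not assumed to be
   symmetric nor to vanish on the diagonal. *)

Definition energy_ratio (R : realType) (N : nat) (c : 'I_N -> 'I_N -> R)
    (S : {set 'I_N}) : R :=
  (\sum_(i in S) \sum_(j in S | (i < j)%N) c i j) / (#|S|%:R - 1).

(* For N >= 2 the full set is admissible, so that starting the iterated
   minimum (resp. maximum) from its ratio does not change the value. *)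
Definition T_plus (R : realType) (N : nat) (c : 'I_N -> 'I_N -> R) : R :=
  - \big[Order.min/energy_ratio c [set: 'I_N]]_(S : {set 'I_N} | (2 <= #|S|)%N)
      energy_ratio c S.

Definition T_minus (R : realType) (N : nat) (c : 'I_N -> 'I_N -> R) : R :=
  - \big[Order.max/energy_ratio c [set: 'I_N]]_(S : {set 'I_N} | (2 <= #|S|)%N)
      energy_ratio c S.

Definition beta_plus (R : realType) (N : nat) (c : 'I_N -> 'I_N -> R) :
    \bar R :=
  if 0 < T_plus c then (1 / T_plus c)%:E else +oo%E.

Definition beta_minus (R : realType) (N : nat) (c : 'I_N -> 'I_N -> R) :
    \bar R :=
  if T_minus c < 0 then (1 / T_minus c)%:E else -oo%E.

Definition coupling_mx (R : realType) (N : nat) (c : 'I_N -> 'I_N -> R) :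
    'M[R]_N :=
  \matrix_(i, j) (if (i < j)%N then c i j
                  else if (j < i)%N then c j i
                  else 0).

Definition is_smallest_eigenvalue (R : realType) (N : nat) (A : 'M[R]_N)
    (l : R) : Prop :=
  eigenvalue A l /\ forall m : R, eigenvalue A m -> l <= m.

Definition is_largest_eigenvalue (R : realType) (N : nat) (A : 'M[R]_N)
    (l : R) : Prop :=
  eigenvalue A l /\ forall m : R, eigenvalue A m -> m <= l.

(* Main.v *)
(* For S with |S| = k >= 2, the Rayleigh quotient of C at the indicator vector
   of S is 2 E(S) / k, where E(S) is the sum of the c(i,j) over pairs in S, so
   E(S) >= lambda_min k / 2.  As lambda_min <= 0 and k / 2 <= k - 1, this gives
   E(S) / (k - 1) >= lambda_min, hence T^+ <= - lambda_min.  The bound on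
   lambda_max follows by replacing c with - c. *)

Require Import Defs.
From mathcomp Require Import all_boot all_order all_algebra.
From mathcomp Require Import reals constructive_ereal.
From mathcomp Require Import complex.

Set Implicit Arguments.
Unset Strict Implicit.
Unset Printing Implicit Defensive.

Import Order.TTheory GRing.Theory Num.Theory.
Local Open Scope ring_scope.

(** From [A = P^-1 D P], row [i] of [P] is a left eigenvector; it is nonzero because [P] is
    invertible. *)
Lemma spectral_diag_eigenvalue (K : numClosedFieldType) n (A : 'M[K]_n)
    (i : 'I_n) :
  A \is normalmx -> eigenvalue A (spectral_diag A 0 i).
Proof.
move=> /orthomx_spectralP; set P := spectralmx A; set d := spectral_diag A.
have Pu : P \in unitmx by exact: spectral_unit.
move=> AE; apply/eigenvalueP; exists (row i P).
  rewrite {1}AE !mulmxA -row_mul mulmxV // row1 -mulmxA.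
  by rewrite -rowE row_mul row_diag_mx -scalemxAl -rowE.
apply/eqP => Pi0; have /(congr1 (mulmx^~ (invmx P))) := Pi0.
rewrite -row_mul mulmxV // mul0mx row1 => /matrixP /(_ 0 i) /eqP.
by rewrite !mxE !eqxx oner_eq0.
Qed.

Section Rayleigh.
Local Open Scope sesquilinear_scope.

(** Over [R[i]] the matrix is Hermitian, so it is unitarily diagonalisable with real spectrum [d].
    In the coordinates [y = X P^*] the form is the sum of [d_j |y_j|^2] and the squared norm is the
    sum of [|y_j|^2], so the smallest [d_j] serves as [l]. *)
Lemma symmetric_rayleigh_min (R : rcfType) n (A : 'M[R]_n.+1) : A^T = A ->
  exists2 l : R, eigenvalue A l &
    forall x : 'rV_n.+1, l * (x *m x^T) 0 0 <= (x *m A *m x^T) 0 0.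
Proof.
move=> Asym; pose toC := real_complex R; pose AC := map_mx toC A.
have real_map m p (B : 'M[R]_(m, p)) : map_mx toC B \is a mxOver Num.real.
  by apply/mxOverP => i j; rewrite mxE; apply/complex_realP; exists (B i j).
have ACherm : AC \is hermsymmx.
  apply: realsym_hermsym; last exact: real_map.
  apply/is_hermitianmxP; rewrite expr0 scale1r map_mx_id //.
  by rewrite /AC map_trmx Asym.
have ACnormal := hermitian_normalmx ACherm.
pose P := spectralmx AC; pose d := spectral_diag AC.
have ACE : AC = invmx P *m diag_mx d *m P by apply/orthomx_spectralP.
have dE j : d 0 j = toC (complex.Re (d 0 j)).
  by rewrite /toC RRe_real //; apply/mxOverP/hermitian_spectral_diag_real.
pose i := [arg min_(j < ord0) complex.Re (d 0 j)]%O.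
exists (complex.Re (d 0 i)).
  (* A real root of the characteristic polynomial of [AC] is a root of that of [A], since the former
     is the image of the latter. *)
  have := spectral_diag_eigenvalue i ACnormal; rewrite -/d dE.
  by rewrite !eigenvalue_root_char /AC -map_char_poly fmorph_root.
move=> x; have le_i j : complex.Re (d 0 i) <= complex.Re (d 0 j).
  by rewrite /i; case: arg_minP => // k _; apply.
pose X := map_mx toC x; pose y := X *m P^t*.
have XE : X^t* = map_mx toC x^T.
  by rewrite map_trmx realmxC ?real_map // map_trmx.
have yE : y^t* = P *m X^t* by rewrite /y trmx_mul map_mxM /= trmxCK.
have PP : P^t* *m P = 1%:M.
  by rewrite -invmx_unitary ?spectral_unitarymx // mulVmx ?spectral_unit.
have norm_y : toC ((x *m x^T) 0 0) = \sum_j `|y 0 j| ^+ 2.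
  transitivity ((y *m y^t*) 0 0).
    rewrite yE /y mulmxA -[X *m _ *m _]mulmxA PP mulmx1 XE -map_mxM.
    by rewrite [RHS](mxE map_mx_key).
  by rewrite mxE; apply: eq_bigr => j _; rewrite !mxE normCK.
have form_y : toC ((x *m A *m x^T) 0 0) = \sum_j d 0 j * `|y 0 j| ^+ 2.
  transitivity ((y *m diag_mx d *m y^t*) 0 0).
    rewrite yE /y -invmx_unitary ?spectral_unitarymx // !mulmxA.
    rewrite -(mulmxA X (invmx P)) -(mulmxA X _ P) -ACE XE -!map_mxM.
    by rewrite [RHS](mxE map_mx_key).
  rewrite mxE; apply: eq_bigr => j _.
  by rewrite mul_mx_diag !mxE normCK mulrCA mulrA.
rewrite -lecR (rmorphM (real_complex R)) /= -/toC form_y norm_y mulr_sumr.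
apply: ler_sum => j _; apply: ler_wpM2r; first exact: exprn_ge0.
by rewrite [leRHS]dE /toC lecR.
Qed.

End Rayleigh.

Lemma mulmx_tr_gt0 (R : realDomainType) n (x : 'rV[R]_n) :
  x != 0 -> 0 < (x *m x^T) 0 0.
Proof.
move=> x0; rewrite lt_neqAle eq_sym mxE; apply/andP; split; last first.
  by apply: sumr_ge0 => j _; rewrite mxE -expr2 sqr_ge0.
apply: contra_neq x0 => /eqP.
rewrite psumr_eq0 => [/allP xx0|j _]; last by rewrite mxE -expr2 sqr_ge0.
apply/rowP => j; have := xx0 j (mem_index_enum j).
by rewrite !mxE -expr2 sqrf_eq0 => /eqP.
Qed.

(** At an eigenvector [v] for [m] the bound reads [l |v|^2 <= m |v|^2], with [|v|^2 > 0]. *)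
Lemma rayleigh_smallest_eigenvalue (R : realType) n (A : 'M[R]_n) l :
  eigenvalue A l ->
  (forall x : 'rV_n, l * (x *m x^T) 0 0 <= (x *m A *m x^T) 0 0) ->
  is_smallest_eigenvalue A l.
Proof.
move=> Al lx; split=> // m /eigenvalueP [v vA /mulmx_tr_gt0 v0].
by have := lx v; rewrite vA -scalemxAl [leRHS]mxE ler_pM2r.
Qed.

Lemma eigenvalueN (F : fieldType) n (A : 'M[F]_n) a :
  eigenvalue (- A) a = eigenvalue A (- a).
Proof.
apply/eigenvalueP/eigenvalueP => -[v vA v0]; exists v => //.
  by rewrite scaleNr -vA mulmxN opprK.
by rewrite mulmxN vA scaleNr opprK.
Qed.

Lemma smallest_eigenvalueN (R : realType) n (A : 'M[R]_n) l :
  is_smallest_eigenvalue (- A) l -> is_largest_eigenvalue A (- l).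
Proof.
rewrite /is_smallest_eigenvalue eigenvalueN => -[Al lmin]; split=> // m Am.
by rewrite lerNr lmin // eigenvalueN opprK.
Qed.

Section Coupling.
Variables (R : realType) (N : nat).
Implicit Types c : 'I_N -> 'I_N -> R.

Lemma coupling_mx_sym c : (coupling_mx c)^T = coupling_mx c.
Proof. by apply/matrixP => i j; rewrite !mxE; case: ltngtP. Qed.

Lemma coupling_mxN c : coupling_mx (fun i j => - c i j) = - coupling_mx c.
Proof.
by apply/matrixP => i j; rewrite !mxE; case: ltngtP; rewrite ?oppr0.
Qed.

Lemma energy_ratioN c S : energy_ratio (fun i j => - c i j) S = - energy_ratio c S.
Proof.
rewrite /energy_ratio -mulNr -sumrN; congr (_ / _).
by apply: eq_bigr => i _; rewrite sumrN.
Qed.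

Lemma T_plusN c : T_plus (fun i j => - c i j) = - T_minus c.
Proof.
rewrite /T_plus /T_minus (big_morph _ (@oppr_max R) (erefl _)) energy_ratioN.
by congr (- _); apply: eq_bigr => S _; rewrite energy_ratioN.
Qed.

Definition indicator_row (S : {set 'I_N}) : 'rV[R]_N :=
  \row_j (j \in S)%:R.

Lemma indicator_row_norm S :
  (indicator_row S *m (indicator_row S)^T) 0 0 = #|S|%:R.
Proof.
rewrite mxE -sum1_card natr_sum [RHS]big_mkcond; apply: eq_bigr => i _.
by rewrite !mxE; case: (i \in S); rewrite ?mulr1 ?mulr0.
Qed.

Lemma indicator_row_coupling c S :
  (indicator_row S *m coupling_mx c *m (indicator_row S)^T) 0 0 =
  (\sum_(i in S) \sum_(j in S | (i < j)%N) c i j) *+ 2.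
Proof.
(* [e] is the strictly upper triangular half of the coupling matrix, which equals [e + e^T];
   exchanging the summations shows that both halves contribute equally. *)
pose e (i j : 'I_N) := if (i < j)%N then c i j else 0.
have -> : \sum_(i in S) \sum_(j in S | (i < j)%N) c i j =
    \sum_(i in S) \sum_(j in S) e i j.
  by apply: eq_bigr => i _; rewrite [LHS]big_mkcondr.
have eE i j : coupling_mx c i j = e i j + e j i.
  by rewrite mxE /e; case: ltngtP; rewrite ?addr0 ?add0r.
transitivity (\sum_(i in S) \sum_(j in S) (e j i + e i j)).
  rewrite mxE [RHS]big_mkcond; apply: eq_bigr => i _.
  rewrite !mxE; case: (i \in S); last by rewrite mulr0.
  rewrite mulr1 [RHS]big_mkcond; apply: eq_bigr => j _.
  by rewrite eE [indicator_row _ _ _]mxE; case: (j \in S); rewrite ?mul1r ?mul0r.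
under eq_bigr => i _ do rewrite big_split.
by rewrite big_split /= exchange_big /= mulr2n.
Qed.

Lemma rayleigh_energy_ratio c (l : R) (S : {set 'I_N}) : l <= 0 -> (2 <= #|S|)%N ->
  (forall x : 'rV_N, l * (x *m x^T) 0 0 <= (x *m coupling_mx c *m x^T) 0 0) ->
  l <= energy_ratio c S.
Proof.
move=> l0 S2 /(_ (indicator_row S)).
rewrite indicator_row_norm indicator_row_coupling /energy_ratio.
move: (\sum_(i in S) _) => E lE; have S2R : 2 <= #|S|%:R :> R by rewrite ler_nat.
have S1 : 0 < #|S|%:R - 1 :> R.
  by rewrite subr_gt0 (lt_le_trans _ S2R) // ltr1n.
(* With [k = #|S|], it remains to show [2 l (k - 1) <= l k]; as [l <= 0], this follows from
   [k <= 2 (k - 1)], that is [2 <= k]. *)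
rewrite ler_pdivlMr // -(ler_pMn2r (ltn0Sn 1)); apply: le_trans lE.
rewrite -mulrnAr ler_wnM2l // mulrnBl mulr2n lerBrDr.
by rewrite lerD2l.
Qed.

Lemma T_plus_le c l : (2 <= N)%N ->
  (forall S : {set 'I_N}, (2 <= #|S|)%N -> l <= energy_ratio c S) ->
  T_plus c <= - l.
Proof.
move=> hN lS; rewrite lerN2; apply: le_bigmin => //.
(* The starting value of the iterated minimum is the ratio of the full set, which has [N >= 2]
   elements. *)
by apply: lS; rewrite cardsT card_ord.
Qed.

(** At the indicator of a singleton the squared norm is 1 and the form vanishes, since no pair
    [i < j] lies in it. *)
Lemma rayleigh_coupling_le0 c (l : R) : (2 <= N)%N ->
  (forall x : 'rV_N, l * (x *m x^T) 0 0 <= (x *m coupling_mx c *m x^T) 0 0) ->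
  l <= 0.
Proof.
move=> hN /(_ (indicator_row [set Ordinal (ltnW hN)])).
rewrite indicator_row_norm indicator_row_coupling cards1 mulr1 big_set1.
by rewrite big1 ?mul0rn // => j /andP[]; rewrite inE => /eqP ->; rewrite ltnn.
Qed.

Lemma coupling_smallest_eigenvalue c : (2 <= N)%N ->
  exists2 l, is_smallest_eigenvalue (coupling_mx c) l & T_plus c <= - l.
Proof.
move=> hN; have [l Al lx] : exists2 l : R, eigenvalue (coupling_mx c) l &
    forall x : 'rV_N, l * (x *m x^T) 0 0 <= (x *m coupling_mx c *m x^T) 0 0.
  move: (coupling_mx c) (coupling_mx_sym c); case: (N) hN => // n _.
  exact: symmetric_rayleigh_min.
exists l; first exact: rayleigh_smallest_eigenvalue.
apply: T_plus_le => // S S2.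
exact: rayleigh_energy_ratio (rayleigh_coupling_le0 hN lx) S2 lx.
Qed.

End Coupling.

(* lmin and lmax are uniquely determined by the first two conjuncts.  The
   conditions lmin != 0 and lmax != 0 say that the quotients are genuine, since
   1 / 0 = 0 in MathComp. *)
Theorem proposition4p1 (R : realType) (N : nat) (hN : (2 <= N)%N)
    (c : 'I_N -> 'I_N -> R) :
  exists lmin lmax : R,
    [/\ is_smallest_eigenvalue (coupling_mx c) lmin,
        is_largest_eigenvalue (coupling_mx c) lmax,
        beta_plus c \is a fin_num ->
          lmin != 0 /\ ((- (1 / lmin))%:E <= beta_plus c)%E
      & beta_minus c \is a fin_num ->
          lmax != 0 /\ (beta_minus c <= (- (1 / lmax))%:E)%E].
Proof.
have [lmin lminP T_le] := coupling_smallest_eigenvalue c hN.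
(* Here [l] is the smallest eigenvalue of [- C], so [- l] is the largest of [C], and the bound
   becomes [l <= T_minus c]. *)
have [l] := coupling_smallest_eigenvalue (fun i j => - c i j) hN.
rewrite coupling_mxN T_plusN lerN2 => /smallest_eigenvalueN lmaxP le_T.
exists lmin, (- l); split=> //.
- rewrite /beta_plus; case: ifP => // T0 _.
  (* Finiteness selects the branch [0 < T_plus c], so [lmin < 0] and inversion reverses
     [T_plus c <= - lmin]. *)
  have l0 : 0 < - lmin by exact: lt_le_trans T_le.
  split; first by rewrite -oppr_eq0 gt_eqF.
  by rewrite lee_fin !div1r -invrN lef_pV2.
- rewrite /beta_minus; case: ifP => // T0 _.
  (* Both [l] and [T_minus c] are negative, and inversion is order-reversing there too. *)
  have l0 : l < 0 by exact: le_lt_trans T0.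
  split; first by rewrite oppr_eq0 lt_eqF.
  by rewrite lee_fin !div1r (invrN l) opprK lef_nV2.
Qed.
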